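(* Let $A:\mathbb{R}^d\to\mathbb{R}^d$ be single-valued, monotone and $M$-Lipschitz ($M>0$), and let $B:\mathbb{R}^d\rightrightarrows\mathbb{R}^d$ be maximally monotone (possibly multivalued). Assume there exists at least one $u^*\in\mathbb{R}^d$ with $0\in A(u^* )+B(u^* )$. Run the Extra Anchored Gradient algorithm described in the context from $u^{-1}\in\mathbb{R}^d$ for $T\in\{1,2,\ldots\}$ iterations with $$\beta_t=\frac{2}{t+3},\qquad \lambda=\frac{1}{\sqrt5\,M}.$$ Then $$\|a^T+b^T\|^2\le\frac{288M^2}{(T+1)^2}\|u^{-1}-u^*\|^2,$$ where $a^T=A(u^T)$ and $b^T\in B(u^T)$ are the vectors produced by the algorithm.
   Context: For $\lambda>0$, the resolvent $J_{\lambda B}$ is defined by $u^+=J_{\lambda B}(u)$ if and only if $\lambda^{-1}(u-u^+)\in B(u^+)$; it is single-valued and defined on all of $\mathbb{R}^d$ since $B$ is maximally monotone. Extra Anchored Gradient algorithm. Input: $u^{-1}\in\mathbb{R}^d$. Parameters: $\lambda>0$, $T\in\{1,2,\ldots\}$, $\{\beta_t\}_{t=0}^{T-1}\subset(0,1)$. Initialize $u^0=J_{\lambda B}(u^{-1}-\lambda A(u^{-1}))$, $a^0=A(u^0)$, $b^0=\frac1\lambda(u^{-1}-\lambda A(u^{-1})-u^0)$ (so $b^0\in B(u^0)$). For $t=0,1,\ldots,T-1$: $u^{t+1/2}=u^t+\beta_t(u^0-u^t)-\lambda(a^t+b^t)$; $u^{t+1}=J_{\lambda B}(u^t+\beta_t(u^0-u^t)-\lambda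 A(u^{t+1/2}))$; $a^{t+1}=A(u^{t+1})$; $b^{t+1}=\frac1\lambda(u^t+\beta_t(u^0-u^t)-\lambda A(u^{t+1/2})-u^{t+1})$ (so $b^{t+1}\in B(u^{t+1})$). Output: $(u^T,a^T+b^T)$. *)

(* Defs.v *)
From HB Require Import structures.
From mathcomp Require Import all_boot all_order all_algebra.
From mathcomp Require Import boolp classical_sets reals.

Set Implicit Arguments.
Unset Strict Implicit.
Unset Printing Implicit Defensive.

Import Order.TTheory GRing.Theory Num.Theory.

Local Open Scope classical_set_scope.
Local Open Scope ring_scope.

(* The norm that MathComp-Analysis puts on matrices (and hence its notation
   k.-lipschitz) is the sup norm, so the Euclidean structure is defined here. *)
Definition inner (R : realType) (d : nat) (x y : 'rV[R]_d) : R :=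
  \sum_(i < d) x 0 i * y 0 i.

Definition enorm (R : realType) (d : nat) (x : 'rV[R]_d) : R :=
  Num.sqrt (inner x x).

Definition elipschitz (R : realType) (d : nat) (M : R)
    (A : 'rV[R]_d -> 'rV[R]_d) : Prop :=
  forall x y, enorm (A x - A y) <= M * enorm (x - y).

Definition monotone_op (R : realType) (d : nat)
    (B : 'rV[R]_d -> set 'rV[R]_d) : Prop :=
  forall x y v w, B x v -> B y w -> 0 <= inner (v - w) (x - y).

Definition maximally_monotone (R : realType) (d : nat)
    (B : 'rV[R]_d -> set 'rV[R]_d) : Prop :=
  monotone_op B /\
  forall C : 'rV[R]_d -> set 'rV[R]_d, monotone_op C ->
    (forall x, B x `<=` C x) -> forall x, C x `<=` B x.

(* The graph of the resolvent: is_resolvent lam B v w reads w = J_{lam B}(v). *)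
Definition is_resolvent (R : realType) (d : nat) (lam : R)
    (B : 'rV[R]_d -> set 'rV[R]_d) (v w : 'rV[R]_d) : Prop :=
  B w (lam^-1 *: (v - w)).

(* A run of T iterations of the Extra Anchored Gradient algorithm from the
   input um1 = u^{-1}. The iterate u^{t+1/2} is uh t; the values of u, a, b
   at indices > T and of uh at indices >= T are unconstrained. *)
Record eag_run (R : realType) (d : nat) (A : 'rV[R]_d -> 'rV[R]_d)
    (B : 'rV[R]_d -> set 'rV[R]_d) (lam : R) (beta : nat -> R) (T : nat)
    (um1 : 'rV[R]_d) (u uh a b : nat -> 'rV[R]_d) : Prop := EagRun {
  eag_u0 : is_resolvent lam B (um1 - lam *: A um1) (u 0%N);
  eag_a0 : a 0%N = A (u 0%N);
  eag_b0 : b 0%N = lam^-1 *: (um1 - lam *: A um1 - u 0%N);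
  eag_uh : forall t, (t < T)%N ->
    uh t = u t + beta t *: (u 0%N - u t) - lam *: (a t + b t);
  eag_uS : forall t, (t < T)%N ->
    is_resolvent lam B
      (u t + beta t *: (u 0%N - u t) - lam *: A (uh t)) (u t.+1);
  eag_aS : forall t, (t < T)%N -> a t.+1 = A (u t.+1);
  eag_bS : forall t, (t < T)%N ->
    b t.+1 =
      lam^-1 *: (u t + beta t *: (u 0%N - u t) - lam *: A (uh t) - u t.+1)
}.

(* Main.v *)
Require Import Defs.
From mathcomp Require Import all_boot all_order all_algebra.
From mathcomp Require Import boolp classical_sets reals.
From mathcomp Require Import ring lra.

(** Write [g t = a t + b t], an element of [(A + B) (u t)].  Since [b t.+1]
    is defined from the resolvent, the implicit step reads
      [u t.+1 = u t + beta t *: (u 0 - u t) - lam *: h]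
    with [h = A (uh t) + b t.+1].  Two facts about [g], [g' = g t.+1] and [h]
    are all that remains of the operators:
    - monotonicity of [A + B] gives [0 <= inner (g' - g) (u t.+1 - u t)];
    - [g' - h = A (u t.+1) - A (uh t)] and [u t.+1 - uh t = lam *: (g - h)],
      so the Lipschitz bound with [(lam * M)^2 = 1/5] gives
      [|g' - h|^2 <= |g - h|^2 / 5].
    These are the facts available for the single-valued method ([B = 0]), so
    a potential-function argument for that method applies unchanged.
    The potential is
      [V t = (t+1)(t+2) ((t+3)/4 * lam * |g t|^2 + inner (g t) (u t - u 0))].
    Its weights are chosen so that [V t - V t.+1] is a combination, with
    nonnegative coefficients, of the two facts above and of the squares
    [|g - h|^2] and [|2 h - g'|^2] ([potential_step]).

    Hence [V T <= V 0 = 3/2 * lam * |g 0|^2].  As [0] belongs to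
    [(A + B) ustar], monotonicity bounds the inner product in [V T] from below
    by [- inner (g T) (u 0 - ustar)], which Young's inequality absorbs into
    the square term.  This bounds [(T+1)^2 * |g T|^2] by [|g 0|^2] and
    [|u 0 - ustar|^2], both of which the initial forward-backward step
    controls by [|um1 - ustar|^2] ([forward_backward_bounds]). *)

Set Implicit Arguments.
Unset Strict Implicit.

Import Order.TTheory GRing.Theory Num.Theory.

Local Open Scope classical_set_scope.
Local Open Scope ring_scope.

(** * The Euclidean inner product *)

Section Inner.
Variables (R : realType) (d : nat).
Implicit Types (x y z : 'rV[R]_d) (k : R).

Lemma innerC x y : inner x y = inner y x.
Proof. by apply: eq_bigr => i _; rewrite mulrC. Qed.

Lemma innerDl x y z : inner (x + y) z = inner x z + inner y z.
Proof. by rewrite -big_split; apply: eq_bigr => i _; rewrite mxE mulrDl. Qed.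

Lemma innerZl k x y : inner (k *: x) y = k * inner x y.
Proof. by rewrite /inner mulr_sumr; apply: eq_bigr => i _; rewrite mxE mulrA. Qed.

Lemma innerNl x y : inner (- x) y = - inner x y.
Proof. by rewrite -scaleN1r innerZl mulN1r. Qed.

Lemma innerDr x y z : inner x (y + z) = inner x y + inner x z.
Proof. by rewrite innerC innerDl !(innerC x). Qed.

Lemma innerZr k x y : inner x (k *: y) = k * inner x y.
Proof. by rewrite innerC innerZl (innerC x). Qed.

Lemma innerNr x y : inner x (- y) = - inner x y.
Proof. by rewrite innerC innerNl (innerC x). Qed.

Definition innerE := (innerDl, innerDr, innerNl, innerNr, innerZl, innerZr).

Lemma inner_sqrD x y :
  inner (x + y) (x + y) = inner x x + 2 * inner x y + inner y y.
Proof. by rewrite !innerE (innerC y x); ring. Qed.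

Lemma inner_ge0 x : 0 <= inner x x.
Proof. by apply: sumr_ge0 => i _; rewrite -expr2 sqr_ge0. Qed.

Lemma enorm_sqr x : enorm x ^+ 2 = inner x x.
Proof. by rewrite sqr_sqrtr ?inner_ge0. Qed.

Lemma inner_young k x y : 0 < k ->
  2 * inner x y <= k * inner x x + k^-1 * inner y y.
Proof.
move=> k0; rewrite -subr_ge0.
have -> : k * inner x x + k^-1 * inner y y - 2 * inner x y
        = k * inner (x - k^-1 *: y) (x - k^-1 *: y).
  by rewrite !innerE (innerC y x); field; rewrite gt_eqF.
by rewrite mulr_ge0 ?inner_ge0 ?ltW.
Qed.

End Inner.

(** * Consequences of monotonicity and Lipschitz continuity *)

Section Operators.
Variables (R : realType) (d : nat).
Variables (A : 'rV[R]_d -> 'rV[R]_d) (B : 'rV[R]_d -> set 'rV[R]_d) (M : R).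
Hypothesis A_mono : monotone_op (fun x => [set A x]).

Lemma sum_monotone (B_mono : monotone_op B) x y v w : B x v -> B y w ->
  0 <= inner ((A x + v) - (A y + w)) (x - y).
Proof.
move=> Bxv Byw; rewrite opprD addrACA innerDl addr_ge0 //.
  exact: A_mono.
exact: B_mono.
Qed.

Hypothesis A_lip : elipschitz M A.

Lemma elipschitz_inner x y :
  inner (A x - A y) (A x - A y) <= M ^+ 2 * inner (x - y) (x - y).
Proof.
rewrite -!enorm_sqr -exprMn; apply: lerXn2r (A_lip x y); rewrite nnegrE.
  exact: sqrtr_ge0.
exact: le_trans (sqrtr_ge0 _) (A_lip x y).
Qed.

End Operators.

(** * The initial forward-backward step *)

Section ForwardBackward.
Variables (R : realType) (d : nat).
Variables (A : 'rV[R]_d -> 'rV[R]_d) (B : 'rV[R]_d -> set 'rV[R]_d).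
Variables (M lam : R).
Hypotheses (lam_gt0 : 0 < lam) (lamM : lam ^+ 2 * M ^+ 2 = 5^-1).
Hypotheses (A_mono : monotone_op (fun x => [set A x])) (A_lip : elipschitz M A).
Hypothesis B_mono : monotone_op B.

(** With [v = lam *: (b - bs)] and [y = w - xs], where [bs = - A xs] is in
    [B xs], the vector [y + v] is the forward step from [x] minus the one from
    [xs], of squared norm at most [6/5 * |x - xs|^2].  Monotonicity of [B] then
    bounds the sum [|y|^2 + |v|^2] and not just [|y|^2], and
    [lam *: (A w + b) = v + lam *: (A w - A xs)] with a second summand of
    squared norm at most [|y|^2 / 5] gives the factor [6/5] once more. *)
Lemma forward_backward_bounds x w xs b :
    B w b -> B xs (- A xs) -> b = lam^-1 *: (x - lam *: A x - w) ->
  inner (w - xs) (w - xs) <= 6 / 5 * inner (x - xs) (x - xs) /\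
  lam ^+ 2 * inner (A w + b) (A w + b) <= 36 / 25 * inner (x - xs) (x - xs).
Proof.
move=> Bw Bxs bE.
have lam_neq0 : lam != 0 by rewrite gt_eqF.
set X := inner (x - xs) (x - xs); set y := w - xs.
set v := lam *: (b + A xs); set e := lam *: (A w - A xs).
have vy_ge0 : 0 <= inner v y.
  have := B_mono Bw Bxs.
  by rewrite opprK /v innerZl => ?; rewrite mulr_ge0 // ltW.
have vyE : v + y = (x - xs) - lam *: (A x - A xs).
  rewrite /v bE /y scalerDr scalerA divff // scale1r scalerBr.
  by apply/rowP => i; rewrite !mxE; ring.
have forward : inner (v + y) (v + y) <= 6 / 5 * X.
  have mono : 0 <= inner (A x - A xs) (x - xs) by exact: A_mono.
  have lip := elipschitz_inner A_lip x xs.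
  rewrite vyE inner_sqrD -scaleNr !innerZr innerZl -/X.
  rewrite [inner (x - xs) _]innerC.
  have := mulr_ge0 (ltW lam_gt0) mono.
  have := ler_wpM2l (sqr_ge0 lam) lip; rewrite [_ * (M ^+ 2 * _)]mulrA lamM -/X.
  lra.
have e_le : inner e e <= 5^-1 * inner y y.
  have := ler_wpM2l (sqr_ge0 lam) (elipschitz_inner A_lip w xs).
  by rewrite [_ * (M ^+ 2 * _)]mulrA lamM /e innerZl innerZr mulrA -expr2.
have v_ge0 := inner_ge0 v.
have vyD := inner_sqrD v y.
split; first lra.
have -> : lam ^+ 2 * inner (A w + b) (A w + b) = inner (v + e) (v + e).
  have -> : v + e = lam *: (A w + b).
    by rewrite /v /e -scalerDr; congr (_ *: _); apply/rowP => i; rewrite !mxE; ring.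
  by rewrite innerZl innerZr mulrA expr2.
have fifth_gt0 : (0 : R) < 5^-1 by lra.
have := inner_young v e fifth_gt0.
by rewrite invrK inner_sqrD; lra.
Qed.

End ForwardBackward.

(** * The potential function *)

Section Potential.
Variables (R : realType) (d : nat).
Implicit Types (lam t : R) (g h w : 'rV[R]_d).

(** The displacement from the anchor is [w]. *)
Definition potential lam t g w : R :=
  (t + 1) * (t + 2) * ((t + 3) / 4 * lam * inner g g + inner g w).

(** The anchored step is [w' = (1 - beta) *: w - lam *: h], [beta = 2/(t+3)].
    The weight [(t+1)(t+2)] is multiplied by [1 / (1 - beta)] at each step, so
    that subtracting [(t+1)(t+2)/beta] times the monotonicity inequality
    cancels all terms containing [w].  What remains is a quadratic form in
    [g, h, g'].  It nearly vanishes on the diagonal [g = h = g'], which forces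
    the leading coefficient [1/4] of the square term; the multiplier
    [lam (t+2)(t+3)(t+5)/4] of the Lipschitz inequality turns it into the sum
    of two squares displayed in the proof. *)
Lemma potential_step lam t g h g' w w' :
    0 <= lam -> 0 <= t ->
    w' = (1 - 2 / (t + 3)) *: w - lam *: h ->
    0 <= inner (g' - g) (w' - w) ->
    5 * inner (g' - h) (g' - h) <= inner (g - h) (g - h) ->
  potential lam (t + 1) g' w' <= potential lam t g w.
Proof.
move=> lam_ge0 t_ge0 w'E mono lip; rewrite -subr_ge0.
have t3_neq0 : t + 3 != 0 by rewrite gt_eqF //; lra.
have -> : potential lam t g w - potential lam (t + 1) g' w' =
    (t + 1) * (t + 2) * (t + 3) / 2 * inner (g' - g) (w' - w)
    + lam * (t + 2) * (t + 3) * (t + 5) / 20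
      * (inner (g - h) (g - h) - 5 * inner (g' - h) (g' - h))
    + lam * (t + 2) * (t + 3) * t / 5 * inner (g - h) (g - h)
    + lam * (t + 2) * (t + 3) / 4 * inner (2 *: h - g') (2 *: h - g').
  rewrite w'E /potential !innerE (innerC h g) (innerC h g').
  by field.
have sq_ge0 := @inner_ge0 R d.
do ![apply: addr_ge0]; apply: mulr_ge0; rewrite ?sq_ge0 ?subr_ge0 //.
all: rewrite ?mulr_ge0 ?invr_ge0 //; lra.
Qed.

End Potential.

(** * The convergence rate *)

Section Rate.
Variables (R : realType) (d : nat).
Variables (A : 'rV[R]_d -> 'rV[R]_d) (B : 'rV[R]_d -> set 'rV[R]_d).
Variables (M lam : R).
Hypotheses (lam_gt0 : 0 < lam) (lamM : lam ^+ 2 * M ^+ 2 = 5^-1).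
Hypotheses (A_mono : monotone_op (fun x => [set A x])) (A_lip : elipschitz M A).
Hypothesis B_mono : monotone_op B.
Variables (T : nat) (um1 : 'rV[R]_d) (u uh a b : nat -> 'rV[R]_d).
Hypothesis run : eag_run A B lam (fun t => 2 / (t + 3)%:R) T um1 u uh a b.

Lemma eag_run_a t : (t <= T)%N -> a t = A (u t).
Proof. by case: t => [|t] ltT; [exact: eag_a0 run | exact: (eag_aS run)]. Qed.

Lemma eag_run_b t : (t <= T)%N -> B (u t) (b t).
Proof.
case: t => [|t] ltT; first by rewrite (eag_b0 run); exact: eag_u0 run.
by rewrite (eag_bS run) //; exact: (eag_uS run).
Qed.

Lemma eag_potential_le t : (t <= T)%N ->
  potential lam t%:R (a t + b t) (u t - u 0%N) <=
  potential lam 0 (a 0%N + b 0%N) 0.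
Proof.
elim: t => [|t IH] ltT; first by rewrite subrr.
have leT := ltnW ltT; apply: le_trans (IH leT).
have lam_neq0 : lam != 0 by rewrite gt_eqF.
pose h := A (uh t) + b t.+1.
have uE : u t.+1 = u t + (2 / (t%:R + 3)) *: (u 0%N - u t) - lam *: h.
  rewrite /h (eag_bS run) // [lam *: (_ + _)]scalerDr scalerA divff // scale1r natrD.
  by apply/rowP => i; rewrite !mxE; ring.
rewrite -natr1; apply: (@potential_step _ _ _ _ _ h); rewrite ?ler0n //.
- exact: ltW.
- by rewrite uE; apply/rowP => i; rewrite !mxE; ring.
- have -> : u t.+1 - u 0%N - (u t - u 0%N) = u t.+1 - u t.
    by rewrite opprB addrA subrK.
  rewrite !eag_run_a //.
  by apply: (sum_monotone A_mono B_mono); exact: eag_run_b.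
have -> : a t.+1 + b t.+1 - h = A (u t.+1) - A (uh t).
  by rewrite eag_run_a // /h opprD addrACA subrr addr0.
have uhE : u t.+1 - uh t = lam *: (a t + b t - h).
  by rewrite (eag_uh run) // natrD uE; apply/rowP => i; rewrite !mxE; ring.
have := elipschitz_inner A_lip (u t.+1) (uh t).
rewrite uhE innerZl innerZr; set G := inner (a t + _ - _) _ => lip.
have : 5 * (M ^+ 2 * (lam * (lam * G))) = G.
  have -> : M ^+ 2 * (lam * (lam * G)) = lam ^+ 2 * M ^+ 2 * G by ring.
  by rewrite lamM mulrA divff ?mul1r // pnatr_eq0.
lra.
Qed.

Lemma eag_rate ustar : B ustar (- A ustar) ->
  (T + 1)%:R ^+ 2 * (lam ^+ 2 * inner (a T + b T) (a T + b T)) <=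
    696 / 25 * inner (um1 - ustar) (um1 - ustar).
Proof.
move=> Bs; set X := inner (um1 - _) _.
have [] := forward_backward_bounds lam_gt0 lamM A_mono A_lip B_mono
  (eag_run_b (leq0n T)) Bs (eag_b0 run).
rewrite -(@eag_run_a 0) //; set g0 := a 0%N + _; set y := u 0%N - _.
rewrite -/X => y_le g0_le.
have := eag_potential_le (leqnn T).
rewrite -/g0 /potential natrD; set g := a T + b T; set n : R := T%:R + 1.
have n_ge1 : 1 <= n by rewrite /n lerDr.
have n_gt0 : 0 < n by lra.
have -> : T%:R + 2 = n + 1 by rewrite /n; ring.
have -> : T%:R + 3 = n + 2 by rewrite /n; ring.
have -> : inner g0 0 = 0 :> R by rewrite -(scale0r 0) innerZr mul0r.
have mono : 0 <= inner g (u T - ustar).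
  have := sum_monotone A_mono B_mono (eag_run_b (leqnn T)) Bs.
  by rewrite -eag_run_a // subrr subr0.
have -> : u T - u 0%N = (u T - ustar) - y by rewrite /y opprB addrA subrK.
rewrite innerDr innerNr => V_le.
(* The weight lets the inner product consume about half of the square term. *)
have lam_n_gt0 : 0 < n * lam / 4 by rewrite !mulr_gt0 ?invr_gt0.
have young := inner_young g y lam_n_gt0.
set N := lam ^+ 2 * inner g g.
have N_ge0 : 0 <= N by rewrite mulr_ge0 ?sqr_ge0 ?inner_ge0.
have X_ge0 : 0 <= X by exact: inner_ge0.
have young' : lam * inner g y <= n / 8 * N + 2 / n * inner y y.
  have := ler_wpM2l (ltW lam_gt0) young.
  have -> : lam * (n * lam / 4 * inner g g + (n * lam / 4)^-1 * inner y y)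
     = n / 4 * N + 4 / n * inner y y.
    by rewrite /N; field; rewrite !gt_eqF.
  lra.
have V_le' : n * (n + 1) * ((n + 2) / 4 * N - lam * inner g y)
    <= 3 / 2 * (36 / 25 * X).
  apply: (@le_trans _ _ (3 / 2 * (lam ^+ 2 * inner g0 g0))); last first.
    by rewrite ler_wpM2l //; lra.
  have := ler_wpM2l (ltW lam_gt0) V_le.
  have : 0 <= n * (n + 1) * (lam * inner g (u T - ustar)).
    by rewrite !mulr_ge0 // ?ltW //; lra.
  by rewrite /N; lra.
have key : n * (n + 1) * ((n + 4) / 8 * N - 2 / n * (6 / 5 * X))
    <= 3 / 2 * (36 / 25 * X).
  apply: le_trans V_le'; rewrite ler_wpM2l //.
    by rewrite mulr_ge0 //; lra.
  have : 2 / n * inner y y <= 2 / n * (6 / 5 * X).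
    by rewrite ler_wpM2l // divr_ge0 // ltW.
  lra.
rewrite -(@ler_pM2l _ (n + 1)); last by lra.
have : 0 <= n * (n + 1) * N by rewrite mulr_ge0 // mulr_ge0 //; lra.
have : 0 <= (n - 1) * X by rewrite mulr_ge0 // subr_ge0.
have : n * (n + 1) * ((n + 4) / 8 * N - 2 / n * (6 / 5 * X))
   = n * (n + 1) * ((n + 4) / 8 * N) - 12 / 5 * (n + 1) * X.
  by field; rewrite gt_eqF.
lra.
Qed.

End Rate.

Unset Implicit Arguments.
Set Strict Implicit.

Theorem theorem2 (R : realType) (d : nat)
    (A : 'rV[R]_d -> 'rV[R]_d) (B : 'rV[R]_d -> set 'rV[R]_d) (M : R)
    (M_gt0 : 0 < M)
    (A_mono : monotone_op (fun x => [set A x]))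
    (A_lip : elipschitz M A)
    (B_max : maximally_monotone B)
    (ustar : 'rV[R]_d)
    (ustar_sol : [set A ustar + v | v in B ustar] 0)
    (T : nat) (T_ge1 : (1 <= T)%N)
    (um1 : 'rV[R]_d) (u uh a b : nat -> 'rV[R]_d)
    (run : eag_run A B (Num.sqrt 5 * M)^-1 (fun t => 2 / (t + 3)%:R) T
             um1 u uh a b) :
  enorm (a T + b T) ^+ 2 <=
    288 * M ^+ 2 / (T + 1)%:R ^+ 2 * enorm (um1 - ustar) ^+ 2.
Proof.
have [B_mono _] := B_max.
have Bs : B ustar (- A ustar).
  by case: ustar_sol => v Bv /eqP; rewrite addrC addr_eq0 => /eqP <-.
set lam := (Num.sqrt 5 * M)^-1 in run.
have lam_gt0 : 0 < lam by rewrite invr_gt0 mulr_gt0 ?sqrtr_gt0.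
have lam2 : lam ^+ 2 = (5 * M ^+ 2)^-1 by rewrite exprVn exprMn sqr_sqrtr.
have lamM : lam ^+ 2 * M ^+ 2 = 5^-1 by rewrite lam2; field; rewrite gt_eqF.
have := eag_rate lam_gt0 lamM A_mono A_lip B_mono run Bs.
rewrite lam2 !enorm_sqr; set G := inner (a T + _) _; set X := inner (um1 - _) _.
have X_ge0 : 0 <= X by exact: inner_ge0.
set n : R := (T + 1)%:R; have n_gt0 : 0 < n by rewrite ltr0n addn1.
have n2_gt0 : 0 < n ^+ 2 by rewrite exprn_gt0.
have M2_gt0 : 0 < M ^+ 2 by rewrite exprn_gt0.
rewrite !mulrA [X in X <= _](_ : _ = n ^+ 2 * G / (5 * M ^+ 2)); last first.
  by field; rewrite gt_eqF.
rewrite ler_pdivrMr ?mulr_gt0 // => rate.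
rewrite mulrAC ler_pdivlMr // mulrC; apply: le_trans rate _.
have : 0 <= M ^+ 2 * X by rewrite mulr_ge0 // ltW.
lra.
Qed.
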